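(* Let $g_n\ge0$, $h_n>0$, $\gamma_n$, $\beta_n$ ($n=0,1,2,\dots$) be sequences of real numbers with $0<h_n\gamma_n<1$, and let $\alpha(n,\cdot)$ be functions with $\alpha(n,g_n)\ge0$ which are nondecreasing in the second argument, i.e. $\alpha(n,g)\ge\alpha(n,q)$ if $g\ge q$. Assume that $$g_{n+1}\le(1-h_n\gamma_n)g_n+h_n\alpha(n,g_n)+h_n\beta_n,\qquad n\ge0.$$ If there exists a sequence $\mu_n>0$ such that $$\alpha\left(n,\frac1{\mu_n}\right)+\beta_n\le\frac1{\mu_n}\left(\gamma_n-\frac{\mu_{n+1}-\mu_n}{h_n\mu_n}\right)\quad\forall n\ge0$$ and $$g_0\le\frac1{\mu_0},$$ then $$0\le g_n\le\frac1{\mu_n}\qquad\forall n\ge0.$$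
   Context: For each integer $n\ge0$, $\alpha(n,\cdot)$ is a real-valued function of a nonnegative real variable. *)

(* Defs.v *)
From Stdlib Require Export Reals.

Open Scope R_scope.

(* A real-valued function of a nonnegative real variable is represented by a
   total [f : R -> R] whose values at negative arguments are unconstrained;
   hence monotonicity is required only on [0, +oo). *)
Definition nondecreasing_on_nonneg (f : R -> R) : Prop :=
  forall q g : R, 0 <= q -> q <= g -> f q <= f g.

(* Main.v *)
Require Import Defs.
From Stdlib Require Import Reals Lra.
Open Scope R_scope.

(** The sequence [1 / mu n] is a supersolution of the recurrence, and the bound
    passes from [n] to [S n] by comparison.  The map
    [x |-> (1 - h n * gamma n) * x + h n * alpha n x] is nondecreasing on
    [0, +oo), because [h n * gamma n < 1], [h n > 0] and [alpha n] is
    nondecreasing there; so [g (S n)] is at most what the recurrence yields with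
    [1 / mu n] in place of [g n].  After inserting the majorization hypothesis
    the terms in [gamma n] cancel, and what remains is
    [1 / mu n - (mu (S n) - mu n) / (mu n)^2], the value at [mu (S n)] of the
    tangent line at [mu n] to the graph of [x |-> 1 / x].  By convexity
    ([inv_above_tangent]) it is at most [1 / mu (S n)]. *)

(** Convexity of the inverse on the positive reals: the gap between the two
    sides is exactly [(y - x)^2 / (x^2 * y)]. *)
Lemma inv_above_tangent (x y : R) :
  0 < x -> 0 < y -> 1 / x - (y - x) / (x * x) <= 1 / y.
Proof.
  intros hx hy.
  assert (hgap : 1 / y - (1 / x - (y - x) / (x * x))
                 = (y - x) * (y - x) * / (x * x * y)) by (field; lra).
  assert (hsq : 0 <= (y - x) * (y - x)) by apply Rle_0_sqr.
  assert (hden : 0 < / (x * x * y)).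
  { apply Rinv_0_lt_compat. repeat apply Rmult_lt_0_compat; assumption. }
  assert (hprod := Rmult_le_pos _ _ hsq (Rlt_le _ _ hden)).
  lra.
Qed.

(** The comparison step for one index, with [m] and [m'] consecutive values of
    the majorizing sequence. *)
Lemma recurrence_step_le_inv (a : R -> R) (h c b x x' m m' : R) :
  0 < h -> h * c < 1 -> nondecreasing_on_nonneg a -> 0 < m -> 0 < m' ->
  a (1 / m) + b <= 1 / m * (c - (m' - m) / (h * m)) ->
  x' <= (1 - h * c) * x + h * a x + h * b ->
  0 <= x <= 1 / m -> x' <= 1 / m'.
Proof.
  intros hh hc ha hm hm' hmaj hrec [hx0 hx].
  assert (hlin : (1 - h * c) * x <= (1 - h * c) * (1 / m))
    by (apply Rmult_le_compat_l; lra).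
  assert (hmono : h * a x <= h * a (1 / m))
    by (apply Rmult_le_compat_l; [lra | exact (ha _ _ hx0 hx)]).
  assert (hsuper := Rmult_le_compat_l h _ _ (Rlt_le _ _ hh) hmaj).
  assert (hcancel : (1 - h * c) * (1 / m)
                    + h * (1 / m * (c - (m' - m) / (h * m)))
                    = 1 / m - (m' - m) / (m * m)) by (field; lra).
  assert (htan := inv_above_tangent m m' hm hm').
  lra.
Qed.

Theorem theorem2
  (g h gamma beta : nat -> R) (alpha : nat -> R -> R)
  (hg : forall n : nat, 0 <= g n)
  (hh : forall n : nat, 0 < h n)
  (hhgamma : forall n : nat, 0 < h n * gamma n < 1)
  (halpha0 : forall n : nat, 0 <= alpha n (g n))
  (halpha : forall n : nat, nondecreasing_on_nonneg (alpha n))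
  (hrec : forall n : nat,
      g (S n) <= (1 - h n * gamma n) * g n + h n * alpha n (g n) + h n * beta n)
  (mu : nat -> R)
  (hmu : forall n : nat, 0 < mu n)
  (hmajor : forall n : nat,
      alpha n (1 / mu n) + beta n
      <= 1 / mu n * (gamma n - (mu (S n) - mu n) / (h n * mu n)))
  (hinit : g 0%nat <= 1 / mu 0%nat) :
  forall n : nat, 0 <= g n <= 1 / mu n.
Proof.
  induction n as [|n IH]; split; try apply hg.
  - exact hinit.
  - exact (recurrence_step_le_inv _ _ _ _ _ _ _ _ (hh n) (proj2 (hhgamma n))
             (halpha n) (hmu n) (hmu (S n)) (hmajor n) (hrec n) IH).
Qed.
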